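(* Let $\mathbb{K}$ be a field of characteristic zero and let $\mathcal{W}_2$ be the terminal algebra of all $2$-dimensional commutative algebras over $\mathbb{K}$. A map $\delta:\mathcal{W}_2\times\mathcal{W}_2\to\mathcal{W}_2$ is a biderivation of $\mathcal{W}_2$ if and only if $\delta$ is the zero mapping; that is, the space $\mathrm{BDer}(\mathcal{W}_2)$ of all biderivations of $\mathcal{W}_2$ is $\{0\}$.
   Context: Algebras are vector spaces over $\mathbb{K}$ with a bilinear multiplication; they need not be associative, commutative or unital. The algebra $\mathcal{W}_2$ (Kantor's algebra of all bilinear commutative operations on a $2$-dimensional space) is the $6$-dimensional algebra over $\mathbb{K}$ with basis $\xi_1,\dots,\xi_6$ and the following multiplication (left factor first; all products of basis elements not listed are $0$): $\xi_1\xi_1=-\xi_1$, $\xi_1\xi_3=\xi_3$, $\xi_1\xi_4=-2\xi_4$, $\xi_1\xi_5=-\xi_5$; $\xi_2\xi_1=-\xi_2$, $\xi_2\xi_2=-2\xi_3$, $\xi_2\xi_4=\xi_1-\xi_5$, $\xi_2\xi_5=\xi_2-2\xi_6$, $\xi_2\xi_6=\xi_3$; $\xi_4\xi_1=\xi_4$, $\xi_4\xi_2=\xi_5-2\xi_1$, $\xi_4\xi_3=-\xi_2+\xi_6$, $\xi_4\xi_5=-2\xi_4$, $\xi_4\xi_6=-\xi_5$; $\xi_5\xi_2=-\xi_2$, $\xi_5\xi_3=-2\xi_3$, $\xi_5\xi_4=\xi_4$, $\xi_5\xi_6=-\xi_6$. A bilinear map $\delta:\mathcal{A}\times\mathcal{A}\to\mathcal{A}$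 on an algebra $\mathcal{A}$ is a biderivation if $\delta(xy,z)=x\,\delta(y,z)+\delta(x,z)\,y$ and $\delta(x,yz)=y\,\delta(x,z)+\delta(x,y)\,z$ for all $x,y,z\in\mathcal{A}$. *)

(* Defs.v *)
From HB Require Import structures.
From mathcomp Require Import all_boot all_order all_algebra.

Set Implicit Arguments.
Unset Strict Implicit.
Unset Printing Implicit Defensive.

Import GRing.Theory.
Local Open Scope ring_scope.

(* A (not necessarily associative, commutative or unital) algebra is a vector
   space A together with a bilinear multiplication mul. *)
Definition biderivation (K : fieldType) (A : lmodType K)
    (mul : {bilinear A -> A -> A}) (delta : A -> A -> A) : Prop :=
  [/\ bilinear_for *:%R *:%R delta,
      forall x y z,
        delta (mul x y) z = mul x (delta y z) + mul (delta x z) y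
    & forall x y z,
        delta x (mul y z) = mul y (delta x z) + mul (delta x y) z].

(* The basis vectors are numbered from 1 to 6, whereas 'I_6 = {0, ..., 5};
   xi K k is 0 for any other k. *)
Definition xi (K : fieldType) (k : nat) : 'rV[K]_6 :=
  \row_(j < 6) (j.+1 == k)%:R.

(* The product of xi_i and xi_j, for 1 <= i, j <= 6. *)
Definition W2_table (K : fieldType) (i j : nat) : 'rV[K]_6 :=
  let xi := xi K in
  match i, j with
  | 1, 1 => - xi 1
  | 1, 3 => xi 3
  | 1, 4 => - 2%:R *: xi 4
  | 1, 5 => - xi 5
  | 2, 1 => - xi 2
  | 2, 2 => - 2%:R *: xi 3
  | 2, 4 => xi 1 - xi 5
  | 2, 5 => xi 2 - 2%:R *: xi 6
  | 2, 6 => xi 3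
  | 4, 1 => xi 4
  | 4, 2 => xi 5 - 2%:R *: xi 1
  | 4, 3 => - xi 2 + xi 6
  | 4, 5 => - 2%:R *: xi 4
  | 4, 6 => - xi 5
  | 5, 2 => - xi 2
  | 5, 3 => - 2%:R *: xi 3
  | 5, 4 => xi 4
  | 5, 6 => - xi 6
  | _, _ => 0
  end.

Definition W2_mul (K : fieldType) (x y : 'rV[K]_6) : 'rV[K]_6 :=
  \sum_(i < 6) \sum_(j < 6) (x 0 i * y 0 j) *: W2_table K i.+1 j.+1.

Lemma W2_mul_is_bilinear (K : fieldType) :
  bilinear_for *:%R *:%R (@W2_mul K).
Proof.
split=> [y | x] a u v /=; rewrite /W2_mul scaler_sumr -big_split /=;
  apply: eq_bigr => i _; rewrite scaler_sumr -big_split /=;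
  apply: eq_bigr => j _ /=; rewrite scalerA -scalerDl !mxE; congr (_ *: _).
- by rewrite mulrDl mulrA.
- by rewrite mulrDr mulrCA.
Qed.

HB.instance Definition _ (K : fieldType) :=
  bilinear_isBilinear.Build K 'rV[K]_6 'rV[K]_6 'rV[K]_6 *:%R *:%R
    (@W2_mul K) (@W2_mul_is_bilinear K).

Lemma W2_mul_xi (K : fieldType) (i j : 'I_6) :
  W2_mul (xi K i.+1) (xi K j.+1) = W2_table K i.+1 j.+1.
Proof.
rewrite /W2_mul (bigD1 i) //= (bigD1 j) //= !mxE !eqxx mulr1 scale1r.
rewrite !big1 ?addr0 // => [k ki | k kj].
- rewrite big1 // => l _; rewrite !mxE eqSS (_ : (k == i :> nat) = false).
    by rewrite mul0r scale0r.
  exact: negbTE.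
- rewrite !mxE [_.+1 == j.+1]eqSS (_ : (k == j :> nat) = false).
    by rewrite mulr0 scale0r.
  exact: negbTE.
Qed.

(* Main.v *)
From HB Require Import structures.
Require Import Defs.
From mathcomp Require Import all_boot all_order all_algebra.
From mathcomp Require Import ring.

(** Fixing either argument of a biderivation delta gives a derivation, and the
    derivations of W_2 are few: if 2 and 3 are invertible, then for each
    derivation D there are scalars a and b such that
      D xi_1 = a xi_2,  D xi_2 = b xi_2 + 2 a xi_3,
      D xi_4 = - a (xi_1 - xi_5) - b xi_4
    ([derivation_shape]).  Hence D is determined by D xi_4: if D xi_4 = 0 then
    D also kills xi_1 and xi_2, and xi_1, xi_2, xi_4 generate W_2
    ([derivation_eq0]).

    It remains to see that delta(xi_4, xi_4) = 0.  Then the derivation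
    delta(xi_4, .) vanishes; so each derivation delta(., y) kills xi_4 and
    vanishes too.  Let D = delta(xi_4, .), with scalars a and b.  The vectors
    D xi_1 = delta(xi_4, xi_1) and D xi_2 = delta(xi_4, xi_2) are images of
    xi_4 under derivations in the other argument, so they lie in the span of
    xi_1 - xi_5 and xi_4.  As their xi_2-coefficients are a and b, both
    scalars are zero. *)

Set Implicit Arguments.
Unset Strict Implicit.
Unset Printing Implicit Defensive.

Import GRing.Theory.
Local Open Scope ring_scope.

Section W2Derivations.
Variable K : fieldType.

Definition vec6 (a1 a2 a3 a4 a5 a6 : K) : 'rV[K]_6 :=
  \row_(j < 6) [:: a1; a2; a3; a4; a5; a6]`_j.

Lemma vec6_surj (x : 'rV[K]_6) :
  exists a1 a2 a3 a4 a5 a6, x = vec6 a1 a2 a3 a4 a5 a6.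
Proof.
exists (x 0 (inord 0)), (x 0 (inord 1)), (x 0 (inord 2)).
exists (x 0 (inord 3)), (x 0 (inord 4)), (x 0 (inord 5)).
apply/rowP => j; rewrite mxE -{1}(inord_val j).
by case: j => [[|[|[|[|[|[|//]]]]]] ?].
Qed.

Lemma vec6_inj a1 a2 a3 a4 a5 a6 b1 b2 b3 b4 b5 b6 :
  vec6 a1 a2 a3 a4 a5 a6 = vec6 b1 b2 b3 b4 b5 b6 ->
  [/\ a1 = b1, a2 = b2 & a3 = b3] /\ [/\ a4 = b4, a5 = b5 & a6 = b6].
Proof.
move=> /rowP e; split; split.
- by have := e (inord 0); rewrite !mxE inordK.
- by have := e (inord 1); rewrite !mxE inordK.
- by have := e (inord 2); rewrite !mxE inordK.
- by have := e (inord 3); rewrite !mxE inordK.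
- by have := e (inord 4); rewrite !mxE inordK.
- by have := e (inord 5); rewrite !mxE inordK.
Qed.

Lemma vec6D a1 a2 a3 a4 a5 a6 b1 b2 b3 b4 b5 b6 :
  vec6 a1 a2 a3 a4 a5 a6 + vec6 b1 b2 b3 b4 b5 b6 =
  vec6 (a1 + b1) (a2 + b2) (a3 + b3) (a4 + b4) (a5 + b5) (a6 + b6).
Proof.
by apply/rowP => -[[|[|[|[|[|[|//]]]]]] ?]; rewrite !mxE.
Qed.

Lemma vec6Z c a1 a2 a3 a4 a5 a6 :
  c *: vec6 a1 a2 a3 a4 a5 a6 =
  vec6 (c * a1) (c * a2) (c * a3) (c * a4) (c * a5) (c * a6).
Proof.
by apply/rowP => -[[|[|[|[|[|[|//]]]]]] ?]; rewrite !mxE.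
Qed.

Lemma vec6N a1 a2 a3 a4 a5 a6 :
  - vec6 a1 a2 a3 a4 a5 a6 = vec6 (- a1) (- a2) (- a3) (- a4) (- a5) (- a6).
Proof.
by apply/rowP => -[[|[|[|[|[|[|//]]]]]] ?]; rewrite !mxE.
Qed.

Lemma vec6_0 : 0 = vec6 0 0 0 0 0 0.
Proof.
by apply/rowP => -[[|[|[|[|[|[|//]]]]]] ?]; rewrite !mxE.
Qed.

Lemma vec6_xi k :
  xi K k = vec6 (1%N == k)%:R (2%N == k)%:R (3%N == k)%:R
                (4%N == k)%:R (5%N == k)%:R (6%N == k)%:R.
Proof.
by apply/rowP => -[[|[|[|[|[|[|//]]]]]] ?]; rewrite !mxE.
Qed.

Definition vec6E := (vec6_xi, vec6Z, vec6N, vec6D).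

Lemma vec6_mul x1 x2 x3 x4 x5 x6 y1 y2 y3 y4 y5 y6 :
  W2_mul (vec6 x1 x2 x3 x4 x5 x6) (vec6 y1 y2 y3 y4 y5 y6) =
  vec6 (- (x1 * y1) + x2 * y4 - 2%:R * (x4 * y2))
       (- (x2 * y1) + x2 * y5 - x4 * y3 - x5 * y2)
       (x1 * y3 - 2%:R * (x2 * y2) + x2 * y6 - 2%:R * (x5 * y3))
       (- (2%:R * (x1 * y4)) + x4 * y1 - 2%:R * (x4 * y5) + x5 * y4)
       (- (x1 * y5) - x2 * y4 + x4 * y2 - x4 * y6)
       (- (2%:R * (x2 * y5)) + x4 * y3 - x5 * y6).
Proof.
rewrite /W2_mul !big_ord_recl !big_ord0 /W2_table /=.
rewrite vec6_0 !mxE /= !vec6E /=.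
by congr vec6; ring.
Qed.

Definition leibniz (D : 'rV[K]_6 -> 'rV[K]_6) :=
  forall x y, D (W2_mul x y) = W2_mul x (D y) + W2_mul (D x) y.

(** Each scalar equation p = q below determines one unknown; the last premise
    of these two facts is the ring identity that isolates it. *)
Let cancel_eq0 (k a p q : K) : k != 0 -> p = q -> k * a = p - q -> a = 0.
Proof. by move=> k0 -> /eqP; rewrite subrr mulf_eq0 (negbTE k0) => /eqP. Qed.

Let solve_eq (a b p q : K) : p = q -> a - b = p - q -> a = b.
Proof. by move=> -> /eqP; rewrite subrr subr_eq0 => /eqP. Qed.

Hypotheses (two_neq0 : 2%:R != 0 :> K) (three_neq0 : 3%:R != 0 :> K).

Let one_neq0 : 1 != 0 :> K := oner_neq0 K.

(** Apart from the factors 2 and 3 that have to be cancelled, everything follows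
    from the images of the products of xi_1, xi_2, xi_4 that stay in their
    span.  As xi_1 xi_1 = - xi_1, xi_1 xi_2 = 0, xi_2 xi_1 = - xi_2 and
    xi_1 xi_4 = -2 xi_4, the four corresponding equations are eigenvector
    equations, perturbed by D xi_1, for multiplications by xi_1; these act
    diagonally on the basis.  They leave three free coefficients, and
    xi_2 xi_4 + xi_4 xi_2 = - xi_1 relates two of them. *)
Lemma derivation_shape (D : {linear 'rV[K]_6 -> 'rV[K]_6}) :
  leibniz D ->
  exists a b, [/\ D (xi K 1) = a *: xi K 2,
    D (xi K 2) = b *: xi K 2 + (2%:R * a) *: xi K 3 &
    D (xi K 4) = - a *: (xi K 1 - xi K 5) - b *: xi K 4].
Proof.
move=> DM.
have [a1 [a2 [a3 [a4 [a5 [a6 Ea]]]]]] := vec6_surj (D (xi K 1)).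
have [b1 [b2 [b3 [b4 [b5 [b6 Eb]]]]]] := vec6_surj (D (xi K 2)).
have [c1 [c2 [c3 [c4 [c5 [c6 Ec]]]]]] := vec6_surj (D (xi K 4)).
have m11 : W2_mul (xi K 1) (xi K 1) = - xi K 1.
  by rewrite !vec6E vec6_mul; congr vec6; rewrite /=; ring.
have m12 : W2_mul (xi K 1) (xi K 2) = 0.
  by rewrite !vec6E vec6_mul vec6_0; congr vec6; rewrite /=; ring.
have m21 : W2_mul (xi K 2) (xi K 1) = - xi K 2.
  by rewrite !vec6E vec6_mul; congr vec6; rewrite /=; ring.
have m14 : W2_mul (xi K 1) (xi K 4) = - 2%:R *: xi K 4.
  by rewrite !vec6E vec6_mul; congr vec6; rewrite /=; ring.
(* D xi_5 is unknown; the symmetrized product of xi_2 and xi_4 avoids it. *)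
have m24 : W2_mul (xi K 2) (xi K 4) + W2_mul (xi K 4) (xi K 2) = - xi K 1.
  by rewrite !vec6E !vec6_mul !vec6E; congr vec6; rewrite /=; ring.
have r11 := DM (xi K 1) (xi K 1).
rewrite m11 linearN /= Ea !vec6E !vec6_mul !vec6E in r11.
case/vec6_inj: r11 => -[/= e1 e2 e3] [_ _ /= e6].
have a1_0 : a1 = 0 by apply: (cancel_eq0 one_neq0 e1); ring.
have a3_0 : a3 = 0 by apply: (cancel_eq0 two_neq0 (esym e3)); ring.
have a6_0 : a6 = 0 by apply: (cancel_eq0 one_neq0 (esym e6)); ring.
have r12 := DM (xi K 1) (xi K 2).
rewrite m12 linear0 /= Ea Eb vec6_0 !vec6E !vec6_mul !vec6E in r12.
case/vec6_inj: r12 => -[/= f1 f2 f3] [/= f4 f5 _].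
have a5_0 : a5 = 0 by apply: (cancel_eq0 one_neq0 f2); ring.
have b4_0 : b4 = 0 by apply: (cancel_eq0 two_neq0 f4); ring.
have b3E : b3 = 2%:R * a2 by apply: (solve_eq (esym f3)); ring.
have r21 := DM (xi K 2) (xi K 1).
rewrite m21 linearN /= Ea Eb !vec6E !vec6_mul !vec6E in r21.
case/vec6_inj: r21 => -[/= g1 _ _] [_ _ /= g6].
have a4_0 : a4 = 0 by apply: (cancel_eq0 one_neq0 (esym g1)); ring.
have b6_0 : b6 = 0.
  by apply: (cancel_eq0 one_neq0 (esym g6)); rewrite a5_0; ring.
have b1_0 : b1 = 0 by apply: (cancel_eq0 one_neq0 f1); rewrite a4_0; ring.
have b5_0 : b5 = 0 by apply: (cancel_eq0 one_neq0 f5); rewrite a4_0; ring.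
have r14 := DM (xi K 1) (xi K 4).
rewrite m14 linearZ /= Ea Ec !vec6E !vec6_mul !vec6E in r14.
case/vec6_inj: r14 => -[/= h1 h2 h3] [_ /= h5 h6].
have c1E : c1 = - a2 by apply: (solve_eq (esym h1)); ring.
have c2_0 : c2 = 0 by apply: (cancel_eq0 two_neq0 (esym h2)); ring.
have c3_0 : c3 = 0 by apply: (cancel_eq0 three_neq0 (esym h3)); ring.
have c5E : c5 = a2 by apply: (solve_eq (esym h5)); ring.
have c6_0 : c6 = 0.
  by apply: (cancel_eq0 two_neq0 (esym h6)); rewrite a5_0; ring.
have r24 :
    D (W2_mul (xi K 2) (xi K 4) + W2_mul (xi K 4) (xi K 2)) = - D (xi K 1).
  by rewrite m24 linearN.
rewrite linearD !DM Ea Eb Ec !vec6E !vec6_mul !vec6E in r24.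
case/vec6_inj: r24 => -[/= k1 _ _] _.
have c4E : c4 = - b2 by apply: (solve_eq (esym k1)); rewrite a1_0; ring.
exists a2, b2; split.
- rewrite Ea !vec6E /=.
  by congr vec6; rewrite ?a1_0 ?a3_0 ?a4_0 ?a5_0 ?a6_0; ring.
- rewrite Eb !vec6E /=.
  by congr vec6; rewrite ?b1_0 ?b3E ?b4_0 ?b5_0 ?b6_0; ring.
- rewrite Ec !vec6E /=.
  by congr vec6; rewrite ?c1E ?c2_0 ?c3_0 ?c4E ?c5E ?c6_0; ring.
Qed.

(** By [derivation_shape] D also kills xi_1 and xi_2; the other basis vectors
    come from xi_2 xi_2 = -2 xi_3, xi_2 xi_4 = xi_1 - xi_5 and
    xi_2 xi_5 = xi_2 - 2 xi_6. *)
Lemma derivation_eq0 (D : {linear 'rV[K]_6 -> 'rV[K]_6}) :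
  leibniz D -> D (xi K 4) = 0 -> forall x, D x = 0.
Proof.
move=> DM D4.
have [a [b [D1 D2 r]]] := derivation_shape DM.
rewrite D4 !vec6E vec6_0 in r; case/vec6_inj: r => -[/= e1 _ _] [/= e4 _ _].
have a0 : a = 0 by apply: (cancel_eq0 one_neq0 e1); ring.
have b0 : b = 0 by apply: (cancel_eq0 one_neq0 e4); ring.
move: D1 D2; rewrite a0 b0 mulr0 !scale0r addr0 => D1 D2.
have D_mul0 x y : D x = 0 -> D y = 0 -> D (W2_mul x y) = 0.
  by move=> Dx Dy; rewrite DM Dx Dy linear0r linear0l addr0.
have D_cancel2 x : D (2%:R *: x) = 0 -> D x = 0.
  by move/eqP; rewrite linearZ scaler_eq0 (negbTE two_neq0) => /eqP.
have D3 : D (xi K 3) = 0.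
  apply: D_cancel2; rewrite (_ : _ *: _ = - W2_mul (xi K 2) (xi K 2)).
    by rewrite linearN D_mul0 ?oppr0.
  by rewrite !vec6E vec6_mul !vec6E; congr vec6; rewrite /=; ring.
have D5 : D (xi K 5) = 0.
  rewrite (_ : xi K 5 = xi K 1 - W2_mul (xi K 2) (xi K 4)).
    by rewrite linearB /= D1 D_mul0 ?subr0.
  by rewrite !vec6E vec6_mul !vec6E; congr vec6; rewrite /=; ring.
have D6 : D (xi K 6) = 0.
  apply: D_cancel2.
  rewrite (_ : _ *: _ = xi K 2 - W2_mul (xi K 2) (xi K 5)).
    by rewrite linearB /= D2 D_mul0 ?subr0.
  by rewrite !vec6E vec6_mul !vec6E; congr vec6; rewrite /=; ring.
move=> x; have [x1 [x2 [x3 [x4 [x5 [x6 ->]]]]]] := vec6_surj x.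
rewrite (_ : vec6 _ _ _ _ _ _ = x1 *: xi K 1 + x2 *: xi K 2 + x3 *: xi K 3
                              + x4 *: xi K 4 + x5 *: xi K 5 + x6 *: xi K 6).
  by rewrite !linearD !linearZ /= D1 D2 D3 D4 D5 D6 !scaler0 !addr0.
by rewrite !vec6E; congr vec6; rewrite /=; ring.
Qed.

End W2Derivations.

Theorem theorem2p6 (K : fieldType) (charK : [pchar K] =i pred0)
    (delta : 'rV[K]_6 -> 'rV[K]_6 -> 'rV[K]_6) :
  biderivation (@W2_mul K) delta <-> (forall x y, delta x y = 0).
Proof.
split=> [[[lin_l lin_r] leib_l leib_r] | delta0]; last first.
  split=> [|x y z|x y z]; last 2 first.
  - by rewrite !delta0 linear0r linear0l addr0.
  - by rewrite !delta0 linear0r linear0l addr0.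
  by split=> [y|x] a u v; rewrite /= !delta0 scaler0 addr0.
have n2 : 2%:R != 0 :> K by move/pcharf0P: charK => ->.
have n3 : 3%:R != 0 :> K by move/pcharf0P: charK => ->.
pose Dl y : {linear 'rV[K]_6 -> 'rV[K]_6} :=
  HB.pack (delta^~ y) (GRing.isLinear.Build K _ _ _ (delta^~ y) (lin_l y)).
pose Dr x : {linear 'rV[K]_6 -> 'rV[K]_6} :=
  HB.pack (delta x) (GRing.isLinear.Build K _ _ _ (delta x) (lin_r x)).
have Dl_leib y : leibniz (Dl y) by move=> u v; apply: leib_l.
have Dr_leib x : leibniz (Dr x).
  by move=> u v; rewrite /= leib_r.
suff D4 : forall x, delta (xi K 4) x = 0.
  by move=> x y; apply: (derivation_eq0 n2 n3 (Dl_leib y) (D4 y)).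
apply: (derivation_eq0 n2 n3 (Dr_leib (xi K 4))).
have [a [b /= [D1 D2 D4]]] := derivation_shape n2 n3 (Dr_leib (xi K 4)).
have [a' [b' [_ _ /= r1]]] := derivation_shape n2 n3 (Dl_leib (xi K 1)).
rewrite D1 !vec6E in r1; case/vec6_inj: r1 => -[_ /= e _] _.
have a0 : a = 0 by rewrite -[a]mulr1 e; ring.
have [a'' [b'' [_ _ /= r2]]] := derivation_shape n2 n3 (Dl_leib (xi K 2)).
rewrite D2 !vec6E in r2; case/vec6_inj: r2 => -[_ /= f _] _.
have b0 : b = 0.
  by move: f; rewrite a0 !mulr0 addr0 mulr1 => ->; ring.
by rewrite D4 a0 b0 oppr0 !scale0r subrr.
Qed.
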